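(* Fix $M>0$, $\mu\ge1$, $0<\varepsilon<1$, $\tau\ge0$, $\sigma>0$, and let $K_M:=([0,M]^2)^\mu$. Let $\mathcal P=(I_1,\dots,I_L)$ be an ordered partition of $\{1,\dots,\mu\}$ and let $\mathcal C_{\mathcal P}\subset K_M$ denote the set of configurations $A=(a^{(1)},\dots,a^{(\mu)})$ whose nondomination layers are exactly indexed by $I_1,\dots,I_L$. For either base indicator $\mathcal I\in\{\mathrm{HV},\ \mathrm{Mag}\circ D\}$, the restriction of $J^{\mathcal I}_{\varepsilon,\tau}$ to $\mathcal C_{\mathcal P}$ is Lipschitz on $K_M\cap\mathcal C_{\mathcal P}$ with respect to the product $\ell^1$ norm $$\|A-B\|_{1,\mu}:=\sum_{i=1}^{\mu}\|a^{(i)}-b^{(i)}\|_1 .$$ More precisely, there exists a constant $\Lambda=\Lambda(M,\mu,\varepsilon,\tau,\sigma)$ (depending only on these quantities) such that $$|J^{\mathcal I}_{\varepsilon,\tau}(A)-J^{\mathcal I}_{\varepsilon,\tau}(B)|\le \Lambda\,\|A-B\|_{1,\mu}\qquad\text{for all }A,B\in K_M\cap\mathcal C_{\mathcal P}.$$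
   Context: Maximization convention: $y\in\mathbb R^2$ strictly dominates $z\in\mathbb R^2$ if $y_i\ge z_i$ for $i=1,2$ and $y\ne z$. The nondomination layers $A^{(1)},\dots,A^{(L)}$ of a labelled configuration $A=(a^{(1)},\dots,a^{(\mu)})$ are obtained by peeling: $A^{(1)}$ consists of the points (indices) not strictly dominated by any other point of $A$; $A^{(2)}$ is the analogous set after removing $A^{(1)}$; and so on until all points are exhausted. The layers are indexed by $I_1,\dots,I_L$ if $A^{(\ell)}=(a^{(i)})_{i\in I_\ell}$ for every $\ell$. For a finite set (or labelled family) $B$ of points of $[0,\infty)^2$: $D(B):=\bigcup_{b\in B}[0,b_1]\times[0,b_2]$, $\mathrm{HV}(B):=\operatorname{area}(D(B))$, $X(B):=\max_{b\in B}b_1$, $Y(B):=\max_{b\in B}b_2$, and $$\mathrm{Mag}(D(B)):=1+\frac{X(B)+Y(B)}{2}+\frac{\mathrm{HV}(B)}{4}.$$ The layered scalar surrogate with repulsion is $$J^{\mathcal I}_{\varepsilon,\tau}(A):=\sum_{\ell=1}^{L}\varepsilon^{\ell-1}\mathcal I(A^{(\ell)})-\tau R_\sigma(A),\qquad R_\sigma(A):=\sum_{1\le i<j\le\mu}\exp\!\Bigl(-\frac{\|a^{(i)}-a^{(j)}\|_2^2}{\sigma^2}\Bigr).$$ *)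

(* Defs.v *)
From HB Require Import structures.
From mathcomp Require Import all_boot all_order all_algebra.
From mathcomp Require Import all_classical all_reals all_analysis.

Set Implicit Arguments.
Unset Strict Implicit.
Unset Printing Implicit Defensive.

Import Order.TTheory GRing.Theory Num.Theory.
Local Open Scope ring_scope.

Section Points.
Variable R : realType.
Implicit Types y z : R * R.

Definition l1norm y : R := `|y.1| + `|y.2|.

Definition l2norm y : R := Num.sqrt (y.1 ^+ 2 + y.2 ^+ 2).

(* Dominance for maximization. *)
Definition sdom y z : bool := [&& z.1 <= y.1, z.2 <= y.2 & y != z].

End Points.

Section Indicators.
Variable R : realType.

(* A finite labelled family of points is given as a list; the order and the
   multiplicities are irrelevant to all the quantities below. *)
Implicit Type B : seq (R * R).

Definition domreg B : set (R * R) :=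
  (\bigcup_(b in [set` B]) (`[0, b.1] `*` `[0, b.2]))%classic.

(* The area of the bounded set [domreg B], as a real number. *)
Definition HV B : R :=
  fine ((@lebesgue_measure R \x @lebesgue_measure R)%E (domreg B)).

(* For nonempty [B] in the nonnegative quadrant, starting the iterated maximum
   at 0 gives the maximum itself. *)
Definition maxX B : R := \big[Num.max/0]_(b <- B) b.1.
Definition maxY B : R := \big[Num.max/0]_(b <- B) b.2.

(* The magnitude of [domreg B], as a function of [B]. *)
Definition magD B : R := 1 + (maxX B + maxY B) / 2 + HV B / 4.

End Indicators.

Section Configurations.
Variables (R : realType) (mu : nat).

Definition config := 'I_mu -> R * R.

Implicit Types (A B : config) (S : {set 'I_mu}).

Definition dist1 A B : R := \sum_(i < mu) l1norm (A i - B i).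

(* The indices in [S] whose points are not strictly dominated by a point
   indexed by [S]. *)
Definition front A S : {set 'I_mu} :=
  [set i in S | [forall j in S, ~~ sdom (A j) (A i)]].

Fixpoint peel A (n : nat) S : seq {set 'I_mu} :=
  if n is n'.+1 then
    if S == finset.set0 then [::]
    else front A S :: peel A n' (S :\: front A S)
  else [::].

(* The front of a nonempty set is nonempty, so [mu] rounds exhaust ['I_mu]. *)
Definition layers A : seq {set 'I_mu} := peel A mu [set: 'I_mu]%SET.

Definition subfamily A S : seq (R * R) := [seq A i | i <- enum S].

Definition repulsion (sigma : R) A : R :=
  \sum_(i < mu) \sum_(j < mu | (i < j)%N)
    expR (- (l2norm (A i - A j) ^+ 2 / sigma ^+ 2)).

(* Layers are numbered from 0, so the exponent of [eps] is the layer number. *)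
Definition surrogate (ind : seq (R * R) -> R) (eps tau sigma : R) A : R :=
  \sum_(l < size (layers A))
    eps ^+ l * ind (subfamily A (nth finset.set0 (layers A) l))
  - tau * repulsion sigma A.

Definition box (M : R) : set config :=
  [set A | forall i, 0 <= (A i).1 <= M /\ 0 <= (A i).2 <= M]%classic.

Definition ordered_partition (P : seq {set 'I_mu}) : bool :=
  uniq P && finset.partition [set S in P]%SET [set: 'I_mu]%SET.

Definition stratum (M : R) (P : seq {set 'I_mu}) : set config :=
  [set A | box M A /\ layers A = P]%classic.

End Configurations.

(* Main.v *)
(* On a stratum the index sets of the layers are constant, so the layers of A
   and B can be compared point by point.  If b moves to a inside [0,M]^2, the
   rectangle [0,a] gains at most two strips of length M and widths |a_1 - b_1|
   and |a_2 - b_2|, whence HV is M-Lipschitz; maxima are 1-Lipschitz.  The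
   Gaussian repulsion is Lipschitz because exp is 1-Lipschitz on the negative
   half-line and the squared distance is Lipschitz on a bounded box. *)

Require Import Defs.
From HB Require Import structures.
From mathcomp Require Import all_boot all_order all_algebra.
From mathcomp Require Import all_classical all_reals all_analysis.
From mathcomp Require Import ring lra.

Set Implicit Arguments.
Unset Strict Implicit.
Unset Printing Implicit Defensive.

Import Order.TTheory GRing.Theory Num.Theory.
Local Open Scope ring_scope.

(** By symmetry the left maximum is the larger one; each of its arguments exceeds its counterpart,
    hence the other maximum, by at most one of the two absolute values. *)
Lemma max_lipschitz (R : realDomainType) (a b x y : R) :
  `|Num.max a x - Num.max b y| <= `|a - b| + `|x - y|.
Proof.
wlog: a b x y / Num.max b y <= Num.max a x => [th|le_m].
  case/orP: (le_total (Num.max b y) (Num.max a x)) => [/th//|/th].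
  by rewrite distrC (distrC b) (distrC y).
rewrite ger0_norm ?subr_ge0// lerBlDr ge_max.
have h1 := ler_norm (a - b); have h2 := ler_norm (x - y).
have n1 := normr_ge0 (a - b); have n2 := normr_ge0 (x - y).
have m1 : b <= Num.max b y by rewrite le_max lexx.
have m2 : y <= Num.max b y by rewrite le_max lexx orbT.
by apply/andP; split; lra.
Qed.

(** * Area of the dominated region and Lipschitz bounds for both indicators *)

Section DominatedRegion.
Variable R : realType.
Implicit Types (a b : R * R) (B : seq (R * R)) (M : R).

Local Notation area := (@lebesgue_measure R \x @lebesgue_measure R)%E.

Definition rect a : set (R * R) := (`[0, a.1] `*` `[0, a.2])%classic.

(** Half-open intervals make a strip empty when the corresponding coordinate does not grow from [b]
    to [a], so no case analysis on their order is needed. *)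
Definition strips M a b : set (R * R) :=
  ((`[0%R, M] `*` `]b.2, a.2]) `|` (`]b.1, a.1] `*` `[0%R, M]))%classic.

Definition in_box M a : bool := (0 <= a.1 <= M) && (0 <= a.2 <= M).

Lemma measurable_rect a : measurable (rect a).
Proof. by apply: measurableX; exact: measurable_itv. Qed.

Lemma measurable_strips M a b : measurable (strips M a b).
Proof.
by apply: measurableU; apply: measurableX; exact: measurable_itv.
Qed.

Lemma domreg_nil : domreg [::] = set0 :> set (R * R).
Proof. by rewrite /domreg bigcup0. Qed.

Lemma domreg_cons a B : domreg (a :: B) = (rect a `|` domreg B)%classic.
Proof.
apply/seteqP; split=> [x [b /=]|x [xa|[b /= bB xb]]].
- by rewrite inE => /predU1P[->|bB] xb; [left | right; exists b].
- by exists a => //=; rewrite mem_head.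
- by exists b => //=; rewrite inE bB orbT.
Qed.

Lemma measurable_domreg B : measurable (domreg B).
Proof.
elim: B => [|a B IH]; first by rewrite domreg_nil.
by rewrite domreg_cons; apply: measurableU => //; exact: measurable_rect.
Qed.

(* Pins the product sigma-algebra, which unification does not recover from
   [area] alone. *)
Lemma areaU_le (A B : set (R * R)) : measurable A -> measurable B ->
  (area (A `|` B)%classic <= area A + area B)%E.
Proof. exact: (measureU2 area). Qed.

Lemma area_itvX (i j : interval R) :
  area ([set` i] `*` [set` j])%classic =
  (lebesgue_measure [set` i] * lebesgue_measure [set` j])%E.
Proof. by apply: product_measure1E; exact: measurable_itv. Qed.

(** [fine] sends infinite values to 0; finiteness ensures that [HV] is the true area, so measure
    inequalities transfer to it. *)
Lemma area_domreg_fin_num B : area (domreg B) \is a fin_num.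
Proof.
elim: B => [|a B IH]; first by rewrite domreg_nil measure0.
rewrite ge0_fin_numE ?measure_ge0// domreg_cons.
apply: (le_lt_trans (areaU_le (measurable_rect a) (measurable_domreg B))).
rewrite lte_add_pinfty//; last by rewrite -ge0_fin_numE ?measure_ge0.
by rewrite area_itvX !lebesgue_measure_itv/=; do 2 case: ifP => _;
  rewrite ?mul0e ?mule0 // -!EFinB -EFinM ltry.
Qed.

Lemma HV_EFin B : (HV B)%:E = area (domreg B).
Proof. by apply: fineK; exact: area_domreg_fin_num. Qed.

(** A point of [rect a] outside [rect b] exceeds [b] in some coordinate; its other coordinate is at
    most [M] because [a] lies in the box. *)
Lemma rect_sub_strips M a b : in_box M a ->
  (rect a `<=` rect b `|` strips M a b)%classic.
Proof.
case/andP => /andP[_ a1M] /andP[_ a2M] [x y] [/=].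
rewrite !in_itv/= => /andP[x0 xa] /andP[y0 ya].
case: (lerP x b.1) => xb; last first.
  right; right; split; rewrite /= in_itv/= ?xb ?xa ?y0//=.
  exact: le_trans ya a2M.
case: (lerP y b.2) => yb; last first.
  right; left; split; rewrite /= in_itv/= ?yb ?ya ?x0//=.
  exact: le_trans xa a1M.
by left; split; rewrite /= in_itv/= ?x0 ?y0.
Qed.

Lemma lebesgue_measure_itvoc_le (x y : R) :
  (lebesgue_measure `]x, y]%classic <= `|y - x|%:E)%E.
Proof.
rewrite lebesgue_measure_itv/=; case: ifP => _; last by rewrite lee_fin.
by rewrite -EFinB lee_fin ler_norm.
Qed.

Lemma area_strips_le M a b : 0 < M ->
  (area (strips M a b) <= (M * l1norm (a - b))%:E)%E.
Proof.
move=> M0.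
have leb0M : lebesgue_measure `[0, M]%classic = M%:E.
  by rewrite lebesgue_measure_itv/= lte_fin M0 -EFinB subr0.
apply: (le_trans (areaU_le _ _)).
- by apply: measurableX; exact: measurable_itv.
- by apply: measurableX; exact: measurable_itv.
(* The first strip measures the change of the second coordinate, so the terms of the norm are
   swapped to match. *)
rewrite /l1norm [`|_| + _]addrC mulrDr EFinD.
apply: leeD; rewrite area_itvX leb0M EFinM; last rewrite muleC.
- by rewrite lee_pmul2l ?lebesgue_measure_itvoc_le.
- by rewrite lee_pmul2l ?lebesgue_measure_itvoc_le.
Qed.

Lemma l1normC (x y : R * R) : l1norm (x - y) = l1norm (y - x).
Proof. by rewrite /l1norm /= distrC [X in _ + X]distrC. Qed.

Lemma l1norm_ge0 (x : R * R) : 0 <= l1norm x.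
Proof. by rewrite addr_ge0. Qed.

Section Families.
Variables (I : Type) (M : R).
Hypothesis M_gt0 : 0 < M.
Implicit Types (f g : I -> R * R) (s : seq I).

(** The families share their index list, so each rectangle of [f] is charged to the rectangle of [g]
    with the same index and to its own strips. *)
Lemma domreg_map_sub f g s : (forall i, in_box M (f i)) ->
  (domreg (map f s) `<=`
   domreg (map g s) `|` \big[setU/set0]_(i <- s) strips M (f i) (g i))%classic.
Proof.
move=> fM; elim: s => [|i s IH] /=; first by rewrite domreg_nil.
rewrite big_cons !domreg_cons => x [/(@rect_sub_strips _ _ (g i) (fM i))|/IH].
  by case=> ?; [left; left | right; left].
by case=> ?; [left; right | right; right].
Qed.

Lemma area_bigsetU_strips_le f g s :
  (area (\big[setU/set0]_(i <- s) strips M (f i) (g i))%classic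
   <= (M * \sum_(i <- s) l1norm (f i - g i))%:E)%E.
Proof.
elim: s => [|i s IH]; first by rewrite !big_nil measure0 mulr0.
rewrite !big_cons mulrDr EFinD.
apply: (le_trans (areaU_le (measurable_strips _ _ _) _)).
  by apply: bigsetU_measurable => j _; exact: measurable_strips.
by apply: leeD => //; exact: area_strips_le.
Qed.

Lemma HV_map_le f g s : (forall i, in_box M (f i)) ->
  HV (map f s) <= HV (map g s) + M * \sum_(i <- s) l1norm (f i - g i).
Proof.
move=> fM; rewrite -lee_fin (EFinD (HV (map g s))).
have := HV_EFin (map f s); have := HV_EFin (map g s).
move: (HV (map f s)) (HV (map g s)) => hf hg -> ->.
have mU : measurable (\big[setU/set0]_(i <- s) strips M (f i) (g i))%classic.
  by apply: bigsetU_measurable => j _; exact: measurable_strips.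
have mD := measurable_domreg (map g s).
apply: (@le_trans _ _ (area (domreg (map g s) `|`
    \big[setU/set0]_(i <- s) strips M (f i) (g i))%classic)).
  apply: le_measure; rewrite ?inE; [exact: measurable_domreg| |].
    exact: measurableU.
  exact: domreg_map_sub.
apply: (le_trans (areaU_le mD mU)).
by rewrite leeD2l// area_bigsetU_strips_le.
Qed.

Lemma HV_lipschitz f g s :
  (forall i, in_box M (f i)) -> (forall i, in_box M (g i)) ->
  `|HV (map f s) - HV (map g s)| <= M * \sum_(i <- s) l1norm (f i - g i).
Proof.
move=> fM gM; rewrite ler_distl lerBlDr.
apply/andP; split; last exact: HV_map_le.
by under eq_bigr do rewrite l1normC; exact: HV_map_le.
Qed.

Lemma bigmax_lipschitz (u v : I -> R) s :
  `|\big[Num.max/0]_(i <- s) u i - \big[Num.max/0]_(i <- s) v i|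
    <= \sum_(i <- s) `|u i - v i|.
Proof.
elim: s => [|i s IH]; first by rewrite !big_nil subrr normr0.
rewrite !big_cons; by apply: le_trans (max_lipschitz _ _ _ _) _; rewrite lerD2l.
Qed.

(** The area contributes [M / 4] and the two maxima contribute [1 / 2]; the rounder [M + 1] also
    dominates the constant [M] of [HV], so it serves both indicators. *)
Lemma magD_lipschitz f g s :
  (forall i, in_box M (f i)) -> (forall i, in_box M (g i)) ->
  `|magD (map f s) - magD (map g s)|
    <= (M + 1) * \sum_(i <- s) l1norm (f i - g i).
Proof.
move=> fM gM; have := HV_lipschitz s fM gM.
rewrite /magD /maxX /maxY !big_map.
have := bigmax_lipschitz (fun i => (f i).1) (fun i => (g i).1) s.
have := bigmax_lipschitz (fun i => (f i).2) (fun i => (g i).2) s.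
have -> : \sum_(i <- s) l1norm (f i - g i) =
    \sum_(i <- s) `|(f i).1 - (g i).1| + \sum_(i <- s) `|(f i).2 - (g i).2|.
  by rewrite -big_split.
set S1 := \sum_(i <- s) `|(f i).1 - _|; set S2 := \sum_(i <- s) `|_ - _|.
have S10 : 0 <= S1 by exact: sumr_ge0.
have S20 : 0 <= S2 by exact: sumr_ge0.
(* The sign of this product is a nonlinear fact that the final [lra] needs. *)
have MS : 0 <= M * (S1 + S2) by rewrite mulr_ge0 ?addr_ge0// ltW.
rewrite [(M + 1) * _]mulrDl mul1r.
move: (HV _) (HV _) (\big[_/_]_(_ <- _) _) (\big[_/_]_(_ <- _) _)
  (\big[_/_]_(_ <- _) _) (\big[_/_]_(_ <- _) _) => hf hg xf yf xg yg.
rewrite !ler_norml => /andP[? ?] /andP[? ?] /andP[? ?].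
by apply/andP; split; lra.
Qed.

End Families.

End DominatedRegion.

(** * Lipschitz bound for one Gaussian term *)

Section Repulsion.
Variable R : realType.
Implicit Types u v : R.

(** For [u <= v] the difference factors as [expR (- u) * (1 - expR (u - v))]: the first factor is at
    most 1, and [1 + t <= expR t] bounds the second by [v - u]. *)
Lemma expRN_lipschitz u v : 0 <= u -> 0 <= v ->
  `|expR (- u) - expR (- v)| <= `|u - v|.
Proof.
wlog uv : u v / u <= v => [th|] u0 v0.
  have [uv|/ltW vu] := leP u v; first exact: th.
  by rewrite distrC (distrC u); exact: th.
rewrite ger0_norm ?subr_ge0 ?ler_expR ?lerN2//.
rewrite distrC ger0_norm ?subr_ge0//.
have -> : expR (- u) - expR (- v) = expR (- u) * (1 - expR (u - v)).
  by rewrite mulrBr mulr1 -expRD; congr (_ - expR _); ring.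
have uv1 : 1 - expR (u - v) <= v - u by have := expR_ge1Dx (u - v); lra.
apply: le_trans uv1; apply: ler_piMl; last by rewrite -expR0 ler_expR oppr_le0.
by rewrite subr_ge0 -expR0 ler_expR subr_le0.
Qed.

Lemma l2norm_sqr (x : R * R) : l2norm x ^+ 2 = x.1 ^+ 2 + x.2 ^+ 2.
Proof. by rewrite sqr_sqrtr// addr_ge0// sqr_ge0. Qed.

(** In the factored difference of squares, the sum factor is at most [2 * M] since both [x - y] and
    [x' - y'] lie between [- M] and [M]. *)
Lemma dist_sqrB_le (M x y x' y' : R) : 0 <= x <= M -> 0 <= y <= M ->
  0 <= x' <= M -> 0 <= y' <= M ->
  `|(x - y) ^+ 2 - (x' - y') ^+ 2| <= 2 * M * (`|x - x'| + `|y - y'|).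
Proof.
move=> /andP[? ?] /andP[? ?] /andP[? ?] /andP[? ?].
have -> : (x - y) ^+ 2 - (x' - y') ^+ 2 =
  (x - y + (x' - y')) * ((x - x') - (y - y')) by ring.
rewrite normrM; apply: ler_pM => //; last exact: ler_normB.
by rewrite ler_norml; apply/andP; split; lra.
Qed.

Lemma gauss_lipschitz (M sigma : R) (a b a' b' : R * R) : 0 < sigma ->
  in_box M a -> in_box M b -> in_box M a' -> in_box M b' ->
  `|expR (- (l2norm (a - b) ^+ 2 / sigma ^+ 2)) -
    expR (- (l2norm (a' - b') ^+ 2 / sigma ^+ 2))|
  <= 2 * M / sigma ^+ 2 * (l1norm (a - a') + l1norm (b - b')).
Proof.
move=> s0 /andP[a1 a2] /andP[b1 b2] /andP[a1' a2'] /andP[b1' b2'].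
have s20 : 0 < sigma ^+ 2 by rewrite exprn_gt0.
apply: le_trans (expRN_lipschitz _ _) _; rewrite ?divr_ge0 ?sqr_ge0//.
rewrite -mulrBl normrM normfV (gtr0_norm s20) mulrAC ler_pM2r ?invr_gt0//.
rewrite !l2norm_sqr /l1norm /=.
have := dist_sqrB_le a1 b1 a1' b1'; have := dist_sqrB_le a2 b2 a2' b2'.
set p := (a.1 - b.1) ^+ 2; set q := (a.2 - b.2) ^+ 2.
set p' := (a'.1 - b'.1) ^+ 2; set q' := (a'.2 - b'.2) ^+ 2.
move=> h2 h1.
have -> : p + q - (p' + q') = (p - p') + (q - q') by ring.
by apply: le_trans (ler_normD _ _) _; apply: le_trans (lerD h1 h2) _; lra.
Qed.

End Repulsion.

(** * Summation over pairs of points and over layers *)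

Section Configurations.
Variables (R : realType) (mu : nat) (M : R).
Implicit Types (A B : config R mu) (S : {set 'I_mu}).

Lemma box_in_box A : box M A -> forall i, in_box M (A i).
Proof. by move=> h i; case: (h i) => h1 h2; apply/andP. Qed.

Lemma l1norm_le_dist1 A B i : l1norm (A i - B i) <= dist1 A B.
Proof.
rewrite /dist1 (bigD1 i)//= lerDl sumr_ge0// => j _; exact: l1norm_ge0.
Qed.

Lemma dist1_ge0 A B : 0 <= dist1 A B.
Proof. by apply: sumr_ge0 => j _; exact: l1norm_ge0. Qed.

Lemma sum_enum_le_dist1 A B S :
  \sum_(i <- enum S) l1norm (A i - B i) <= dist1 A B.
Proof.
rewrite big_enum /= /dist1 (bigID (mem S) xpredT)/= lerDl sumr_ge0// => j _.
exact: l1norm_ge0.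
Qed.

(** This bounds the number of layers by [mu], uniformly in the partition. *)
Lemma size_peel A n S : (size (peel A n S) <= n)%N.
Proof. by elim: n S => //= n IH S; case: ifP => //= _; exact: IH. Qed.

Lemma repulsion_lipschitz (sigma : R) A B : 0 < M -> 0 < sigma ->
  box M A -> box M B ->
  `|repulsion sigma A - repulsion sigma B|
    <= mu%:R * (mu%:R * (2 * M / sigma ^+ 2 * (2 * dist1 A B))).
Proof.
move=> M0 s0 /box_in_box AM /box_in_box BM.
set c := 2 * M / sigma ^+ 2.
have c0 : 0 <= c by rewrite divr_ge0 ?sqr_ge0// mulr_ge0 ?ltW.
have d0 : 0 <= c * (2 * dist1 A B) by rewrite mulr_ge0// mulr_ge0// dist1_ge0.
(* Allowing a filter [P] lets one bound serve both the outer sum and the inner sum over [i < j]. *)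
have sum_le (P : pred 'I_mu) (F : 'I_mu -> R) K : 0 <= K ->
    (forall i, P i -> `|F i| <= K) -> `|\sum_(i < mu | P i) F i| <= mu%:R * K.
  move=> K0 FK; apply: le_trans (ler_norm_sum _ _ _) _.
  rewrite big_mkcond/= mulr_natl -[X in _ *+ X]card_ord -sumr_const.
  by apply: ler_sum => i _; case: ifP => // /FK.
rewrite /repulsion -sumrB; apply: (sum_le) => [|i _].
  by rewrite mulr_ge0 ?ler0n.
rewrite -sumrB; apply: (sum_le) => // j _.
apply: le_trans (gauss_lipschitz s0 (AM i) (AM j) (BM i) (BM j)) _.
(* The factor 2 arises because both points of a pair may move, each by at most [dist1 A B]. *)
by rewrite ler_wpM2l// mulrDl mul1r lerD ?l1norm_le_dist1.
Qed.

Lemma layered_sum_lipschitz (ind : seq (R * R) -> R) (eps K : R)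
    (P : seq {set 'I_mu}) A B :
  0 <= eps <= 1 -> 0 <= K ->
  (forall S, `|ind (subfamily A S) - ind (subfamily B S)| <= K) ->
  `|\sum_(l < size P) eps ^+ l * ind (subfamily A (nth finset.set0 P l)) -
    \sum_(l < size P) eps ^+ l * ind (subfamily B (nth finset.set0 P l))|
  <= (size P)%:R * K.
Proof.
move=> /andP[e0 e1] K0 indK; rewrite -sumrB.
apply: le_trans (ler_norm_sum _ _ _) _.
rewrite mulr_natl -[X in _ *+ X]card_ord -sumr_const.
apply: ler_sum => l _; rewrite -mulrBr normrM ger0_norm ?exprn_ge0//.
apply: le_trans (indK (nth finset.set0 P l)).
by rewrite ler_piMl// exprn_ile1.
Qed.

End Configurations.

Theorem theorem1 (R : realType) (M : R) (mu : nat) (eps tau sigma : R)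
    (hM : 0 < M) (hmu : (1 <= mu)%N) (heps0 : 0 < eps) (heps1 : eps < 1)
    (htau : 0 <= tau) (hsigma : 0 < sigma) :
  exists Lambda : R,
    forall P : seq {set 'I_mu}, ordered_partition P ->
    forall ind : seq (R * R) -> R, ind = @HV R \/ ind = @magD R ->
    forall A B : config R mu,
      (box M `&` stratum M P)%classic A -> (box M `&` stratum M P)%classic B ->
      `| surrogate ind eps tau sigma A - surrogate ind eps tau sigma B |
        <= Lambda * dist1 A B.
Proof.
(* At most [mu] layers, each with weight at most 1 and constant [M + 1], give the first summand;
   [tau] times the repulsion constant gives the second. *)
exists (mu%:R * (M + 1) + tau * (mu%:R * (mu%:R * (2 * M / sigma ^+ 2 * 2)))).
move=> P _ ind hind A B [bA [_ lA]] [bB [_ lB]].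
have M1 : 0 <= M + 1 by rewrite addr_ge0 ?ltW.
have ind_lip S : `|ind (subfamily A S) - ind (subfamily B S)|
    <= (M + 1) * dist1 A B.
  apply: (@le_trans _ _ ((M + 1) * \sum_(i <- enum S) l1norm (A i - B i))).
    have AM := box_in_box bA; have BM := box_in_box bB.
    case: hind => ->; last exact: magD_lipschitz.
    apply: le_trans (HV_lipschitz hM _ AM BM) _.
    rewrite ler_wpM2r ?lerDl//.
    by apply: sumr_ge0 => i _; exact: l1norm_ge0.
  by rewrite ler_wpM2l// sum_enum_le_dist1.
have d0 := dist1_ge0 A B.
have K0 : 0 <= (M + 1) * dist1 A B by rewrite mulr_ge0.
have e01 : 0 <= eps <= 1 by rewrite !ltW.
have layered := layered_sum_lipschitz P e01 K0 ind_lip.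
have sizeP : (size P)%:R * ((M + 1) * dist1 A B)
    <= mu%:R * ((M + 1) * dist1 A B).
  by rewrite ler_wpM2r// ler_nat -lA size_peel.
have rep := repulsion_lipschitz hM hsigma bA bB.
(* Both layered sums now run over the same index sets [P], which is what makes the layerwise
   comparison possible. *)
rewrite /surrogate lA lB.
set x := \sum_(l < _) _ in layered *; set y := \sum_(l < _) _ in layered *.
have -> : x - tau * repulsion sigma A - (y - tau * repulsion sigma B) =
  (x - y) - tau * (repulsion sigma A - repulsion sigma B) by ring.
apply: le_trans (ler_normB _ _) _; rewrite mulrDl; apply: lerD.
  by apply: le_trans layered _; rewrite -mulrA.
rewrite normrM (ger0_norm htau) -mulrA ler_wpM2l//.
by rewrite -!mulrA in rep *.
Qed.
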